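(* Let $R$ and $S$ be two rings with local units. Then the following conditions are equivalent. (a) The rings $R$ and $S$ are Morita equivalent. (b) There exists an additive covariant equivalence $\mathrm{Proj}R\rightarrow \mathrm{Proj}S$ which preserves and reflects finitely generated projective unitary modules. (c) There exists an additive covariant equivalence $\mathrm{proj}R\rightarrow\mathrm{proj}S$.
   Context: Rings are associative, not necessarily with identity. A ring $R$ has local units if every finite subset of $R$ is contained in a subring of the form $eRe$ with $e^2=e\in R$. A left $R$-module $M$ is unitary if $RM=M$; $R\mathrm{Mod}$ is the category of unitary left $R$-modules. $R$ and $S$ are Morita equivalent if there exists an additive covariant equivalence between $R\mathrm{Mod}$ and $S\mathrm{Mod}$. $\mathrm{Proj}R$ is the full subcategory of $R\mathrm{Mod}$ of unitary left $R$-modules which are projective in $R\mathrm{Mod}$; $\mathrm{proj}R$ is the full subcategory of those which are moreover finitely generated. An equivalence $F$ preserves and reflects finitely generated projective unitary modules if, for $X\in\mathrm{Proj}R$, $X$ is finitely generated if and only if $F(X)$ is. *)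

(* Defs.v *)
From HB Require Import structures.
From mathcomp Require Import all_boot all_order all_algebra.
From mathcomp Require Import boolp classical_sets functions.

Set Implicit Arguments.
Unset Strict Implicit.
Unset Printing Implicit Defensive.

Import GRing.Theory.

Local Open Scope classical_set_scope.
Local Open Scope ring_scope.

Record preadditive := Preadditive {
  obj :> Type;
  mor : obj -> obj -> zmodType;
  idm : forall X, mor X X;
  cmp : forall X Y Z, mor Y Z -> mor X Y -> mor X Z;
  cmp1m : forall X Y (f : mor X Y), cmp (idm Y) f = f;
  cmpm1 : forall X Y (f : mor X Y), cmp f (idm X) = f;
  cmpA : forall X Y Z W (h : mor Z W) (g : mor Y Z) (f : mor X Y),
    cmp h (cmp g f) = cmp (cmp h g) f;
  cmpDl : forall X Y Z (g g' : mor Y Z) (f : mor X Y),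
    cmp (g + g') f = cmp g f + cmp g' f;
  cmpDr : forall X Y Z (g : mor Y Z) (f f' : mor X Y),
    cmp g (f + f') = cmp g f + cmp g f' }.

Arguments mor {p} X Y.
Arguments idm {p} X.
Arguments cmp {p X Y Z} g f.

Definition isomorphism (C : preadditive) (X Y : C) (f : mor X Y) : Prop :=
  exists g : mor Y X, cmp g f = idm X /\ cmp f g = idm Y.

Definition epimorphism (C : preadditive) (X Y : C) (f : mor X Y) : Prop :=
  forall (Z : C) (g h : mor Y Z), cmp g f = cmp h f -> g = h.

Definition projective (C : preadditive) (P : C) : Prop :=
  forall (X Y : C) (g : mor X Y), epimorphism g ->
  forall f : mor P Y, exists h : mor P X, cmp g h = f.

Definition full_subcategory (C : preadditive) (P : C -> Prop) : preadditive :=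
  @Preadditive {X : C | P X} (fun X Y => mor (sval X) (sval Y))
    (fun X => idm (sval X)) (fun _ _ _ g f => cmp g f)
    (fun _ _ f => cmp1m f) (fun _ _ f => cmpm1 f)
    (fun _ _ _ _ h g f => cmpA h g f)
    (fun _ _ _ g g' f => cmpDl g g' f) (fun _ _ _ g f f' => cmpDr g f f').

Record functor (C D : preadditive) := Functor {
  fobj :> C -> D;
  fmap : forall X Y : C, mor X Y -> mor (fobj X) (fobj Y);
  fmap1 : forall X, fmap (idm X) = idm (fobj X);
  fmapM : forall X Y Z (g : mor Y Z) (f : mor X Y),
    fmap (cmp g f) = cmp (fmap g) (fmap f) }.

Arguments fmap {C D} F {X Y} f : rename.

Definition functor_id (C : preadditive) : functor C C :=
  @Functor C C id (fun _ _ f => f) (fun _ => erefl) (fun _ _ _ _ _ => erefl).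

Lemma functor_comp1 (C D E : preadditive) (G : functor D E) (F : functor C D) X :
  fmap G (fmap F (idm X)) = idm (G (F X)).
Proof. by rewrite !fmap1. Qed.

Lemma functor_compM (C D E : preadditive) (G : functor D E) (F : functor C D)
    X Y Z (g : mor Y Z) (f : mor X Y) :
  fmap G (fmap F (cmp g f)) = cmp (fmap G (fmap F g)) (fmap G (fmap F f)).
Proof. by rewrite !fmapM. Qed.

Definition functor_comp (C D E : preadditive) (G : functor D E)
    (F : functor C D) : functor C E :=
  @Functor C E (fun X => G (F X)) (fun _ _ f => fmap G (fmap F f))
    (functor_comp1 G F) (@functor_compM C D E G F).

Definition additive_functor (C D : preadditive) (F : functor C D) : Prop :=
  forall (X Y : C) (f g : mor X Y), fmap F (f + g) = fmap F f + fmap F g.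

Definition naturally_isomorphic (C D : preadditive) (F G : functor C D) : Prop :=
  exists eta : forall X, mor (F X) (G X),
    (forall X, isomorphism (eta X)) /\
    (forall (X Y : C) (f : mor X Y),
       cmp (eta Y) (fmap F f) = cmp (fmap G f) (eta X)).

Definition equivalence (C D : preadditive) (F : functor C D) : Prop :=
  exists G : functor D C,
    naturally_isomorphic (functor_comp G F) (functor_id C) /\
    naturally_isomorphic (functor_comp F G) (functor_id D).

Record rng := Rng {
  rng_sort :> zmodType;
  rmul : rng_sort -> rng_sort -> rng_sort;
  rmulA : forall x y z, rmul x (rmul y z) = rmul (rmul x y) z;
  rmulDl : forall x y z, rmul (x + y) z = rmul x z + rmul y z;
  rmulDr : forall x y z, rmul x (y + z) = rmul x y + rmul x z }.

Arguments rmul {r} _ _.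

(** [corner e] is the subring eRe. *)
Definition corner (R : rng) (e : R) : set R :=
  [set rmul (rmul e r) e | r in [set: R]].

(** Finite subsets are represented by the finite sequences enumerating them. *)
Definition has_local_units (R : rng) : Prop :=
  forall s : seq R, exists e : R, rmul e e = e /\ [set` s] `<=` corner e.

Record lmodule (R : rng) := LModule {
  lmodule_sort :> zmodType;
  act : R -> lmodule_sort -> lmodule_sort;
  actA : forall r s x, act r (act s x) = act (rmul r s) x;
  actDl : forall r s x, act (r + s) x = act r x + act s x;
  actDr : forall r x y, act r (x + y) = act r x + act r y }.

Arguments act {R l} _ _.

Section ModuleHom.
Variables (R : rng) (M N : lmodule R).

Definition linear_hom (f : M -> N) : Prop :=
  (forall x y, f (x + y) = f x + f y) /\ (forall r x, f (act r x) = act r (f x)).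

Definition linear_homb : pred (M -> N) := fun f => `[< linear_hom f >].

Record module_hom := ModuleHom {
  module_hom_fun :> M -> N;
  module_homP : linear_homb module_hom_fun }.

HB.instance Definition _ := [isSub for module_hom_fun].
HB.instance Definition _ := [Choice of module_hom by <:].

Lemma act0r r : act r 0 = 0 :> N.
Proof. by apply: (addrI (act r 0)); rewrite -actDr !addr0. Qed.

Lemma actBr r (x y : N) : act r (x - y) = act r x - act r y.
Proof. by apply: (addIr (act r y)); rewrite -actDr !subrK. Qed.

Lemma linear_homb_zmod_closed : zmod_closed linear_homb.
Proof.
split; first by apply/asboolP; split=> *; rewrite ?addr0 ?act0r.
move=> f g /asboolP[fD fZ] /asboolP[gD gZ]; apply/asboolP; split=> [x y|r x].
  by rewrite /= !fctE fD gD opprD addrACA.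
by rewrite /= !fctE fZ gZ actBr.
Qed.

HB.instance Definition _ :=
  GRing.isZmodClosed.Build (M -> N) linear_homb linear_homb_zmod_closed.
HB.instance Definition _ := [SubChoice_isSubZmodule of module_hom by <:].

End ModuleHom.

Lemma module_hom_ext (R : rng) (M N : lmodule R) (f g : module_hom M N) :
  f =1 g -> f = g.
Proof. by move=> fg; apply: val_inj; apply: funext. Qed.

Lemma module_homD (R : rng) (M N : lmodule R) (f g : module_hom M N) x :
  (f + g) x = f x + g x.
Proof. by []. Qed.

Lemma module_hom_add (R : rng) (M N : lmodule R) (f : module_hom M N) x y :
  f (x + y) = f x + f y.
Proof. by case: f => f /= /asboolP[]. Qed.

Lemma module_hom_act (R : rng) (M N : lmodule R) (f : module_hom M N) r x :
  f (act r x) = act r (f x).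
Proof. by case: f => f /= /asboolP[]. Qed.

Lemma module_id_subproof (R : rng) (M : lmodule R) : linear_homb (id : M -> M).
Proof. by apply/asboolP. Qed.

Definition module_id (R : rng) (M : lmodule R) : module_hom M M :=
  ModuleHom (module_id_subproof M).

Lemma module_comp_subproof (R : rng) (M N P : lmodule R)
    (g : module_hom N P) (f : module_hom M N) : linear_homb (g \o f).
Proof.
by apply/asboolP; split=> [x y|r x];
  rewrite /= ?module_hom_add ?module_hom_act.
Qed.

Definition module_comp (R : rng) (M N P : lmodule R)
    (g : module_hom N P) (f : module_hom M N) : module_hom M P :=
  ModuleHom (module_comp_subproof g f).

Definition all_modules (R : rng) : preadditive.
Proof.
refine (@Preadditive (lmodule R) (fun M N => module_hom M N : zmodType)
  (@module_id R) (@module_comp R) _ _ _ _ _).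
- by move=> M N f; apply: module_hom_ext.
- by move=> M N f; apply: module_hom_ext.
- by move=> M N P Q h g f; apply: module_hom_ext.
- by move=> M N P g g' f; apply: module_hom_ext.
- by move=> M N P g f f'; apply: module_hom_ext => x; apply: module_hom_add.
Defined.

(** RM is the set of finite sums of products r x. *)
Definition unitary (R : rng) (M : lmodule R) : Prop :=
  forall x : M, exists s : seq (R * M), x = \sum_(p <- s) act p.1 p.2.

Definition submodule (R : rng) (M : lmodule R) (N : set M) : Prop :=
  [/\ N 0, (forall x y, N x -> N y -> N (x - y)) &
      (forall r x, N x -> N (act r x))].

(** Without an identity, x need not lie in Rx, so generation is expressed
    through submodules rather than through sums of multiples. *)
Definition finitely_generated (R : rng) (M : lmodule R) : Prop :=
  exists s : seq M,
    forall N : set M, submodule N -> [set` s] `<=` N -> N = [set: M].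

Definition RMod (R : rng) : preadditive :=
  @full_subcategory (all_modules R) (@unitary R).

Definition RMod_module (R : rng) (M : RMod R) : lmodule R := sval M.

Definition ProjMod (R : rng) : preadditive :=
  full_subcategory (@projective (RMod R)).

Definition Proj_module (R : rng) (P : ProjMod R) : lmodule R :=
  RMod_module (sval P).

Definition projMod (R : rng) : preadditive :=
  @full_subcategory (RMod R)
    (fun M => projective M /\ finitely_generated (RMod_module M)).

Definition Morita_equivalent (R S : rng) : Prop :=
  exists F : functor (RMod R) (RMod S), additive_functor F /\ equivalence F.

Definition preserves_reflects_fg (R S : rng)
    (F : functor (ProjMod R) (ProjMod S)) :
  Prop :=
  forall X : ProjMod R,
    finitely_generated (Proj_module X) <->
    finitely_generated (Proj_module (F X)).

(* Main.v *)
(** (a) => (b) => (c): a module is finitely generated iff every jointly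
    epimorphic family of maps into it has a finite jointly epimorphic subfamily.
    Like projectivity this is a categorical condition on RMod, so equivalences
    preserve and reflect it.

    (c) => (a): a unitary S-module is determined by the groups eN = Hom(Se, N)
    over the idempotents e, so an additive functor G from proj S to proj R turns a
    unitary R-module M into the S-module whose e-components are Hom(G(Se), M),
    that is, the colimit over e of these groups.  A dual basis of a finitely
    generated projective P gives Hom(P, GM) = Hom(G P, M), natural in P and M.
    If F is inverse to G, then the e-components of FGM are Hom(F(Re), GM) =
    Hom(G(F(Re)), M) = Hom(Re, M) = eM, so that FGM = M. *)
Require Import Defs.
From HB Require Import structures.
From mathcomp Require Import all_boot all_algebra.
From mathcomp Require Import generic_quotient ring_quotient.
From mathcomp Require Import boolp classical_sets functions.

Set Implicit Arguments.
Unset Strict Implicit.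
Unset Printing Implicit Defensive.

Import GRing.Theory.

Local Open Scope classical_set_scope.
Local Open Scope ring_scope.
Local Open Scope quotient_scope.

(** * Equivalences of preadditive categories *)

Section Categories.
Variables C D : preadditive.

(** Keeps the quasi-inverse explicit, so that each lemma below can be applied again with the two
    functors exchanged. *)
Definition mutually_inverse (F : functor C D) (G : functor D C) : Prop :=
  naturally_isomorphic (functor_comp G F) (functor_id C) /\
  naturally_isomorphic (functor_comp F G) (functor_id D).

Lemma natural_iso_inverse (F G : functor C D) :
  naturally_isomorphic F G ->
  exists (u : forall X, mor (F X) (G X)) (v : forall X, mor (G X) (F X)),
    [/\ forall X, cmp (v X) (u X) = idm (F X),
        forall X, cmp (u X) (v X) = idm (G X),
        forall X Y (f : mor X Y), cmp (u Y) (fmap F f) = cmp (fmap G f) (u X) &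
        forall X Y (f : mor X Y), cmp (v Y) (fmap G f) = cmp (fmap F f) (v X)].
Proof.
move=> [u [iu nu]].
pose v X := sval (cid (iu X)); exists u, v.
have vu X : cmp (v X) (u X) = idm (F X) by rewrite /v; case: cid => ? [].
have uv X : cmp (u X) (v X) = idm (G X) by rewrite /v; case: cid => ? [].
split=> // X Y f.
by rewrite -[LHS]cmpm1 -uv -!cmpA [cmp (fmap G f) _]cmpA -nu !cmpA vu cmp1m.
Qed.

Lemma natural_iso_sym (F G : functor C D) :
  naturally_isomorphic F G -> naturally_isomorphic G F.
Proof.
move=> /natural_iso_inverse[u [v [vu uv _ nv]]].
by exists v; split=> // X; exists (u X).
Qed.

Definition faithful (F : functor C D) : Prop :=
  forall X Y (f g : mor X Y), fmap F f = fmap F g -> f = g.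

(** The predicate A selects the members that count, so that passing to a subfamily leaves the family
    itself unchanged. *)
Definition jointly_epi (I : Type) (A : I -> Prop) (P : C) (X : I -> C)
    (f : forall i, mor (X i) P) : Prop :=
  forall Z (g h : mor P Z),
    (forall i, A i -> cmp g (f i) = cmp h (f i)) -> g = h.

(** The categorical form of finite generation; see [fg_compact] and [compact_fg]. *)
Definition compact_object (P : C) : Prop :=
  forall (I : eqType) (X : I -> C) (f : forall i, mor (X i) P),
    jointly_epi setT f -> exists s : seq I, jointly_epi [set` s] f.

End Categories.

Lemma mutually_inverse_sym C D (F : functor C D) (G : functor D C) :
  mutually_inverse F G -> mutually_inverse G F.
Proof. by move=> []. Qed.

Lemma faithful_left_inverse C D (F : functor C D) (G : functor D C) :
  naturally_isomorphic (functor_comp G F) (functor_id C) -> faithful F.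
Proof.
move=> /natural_iso_inverse[u [v [_ uv nu _]]] X Y f g efg.
rewrite /= in nu uv.
by rewrite -[f]cmpm1 -[g]cmpm1 -uv !cmpA -!nu efg.
Qed.

Section Equivalences.
Variables (C D : preadditive) (F : functor C D) (G : functor D C).
Hypothesis FG : mutually_inverse F G.

Let faithF : faithful F := faithful_left_inverse FG.1.
Let faithG : faithful G := faithful_left_inverse FG.2.

(** The preimage is G h conjugated by u and v; since G is faithful, it is enough to compare G (F f)
    with G h. *)
Lemma equivalence_full X Y (h : mor (F X) (F Y)) : exists f, fmap F f = h.
Proof.
have [u [v [vu uv nu nv]]] := natural_iso_inverse FG.1; rewrite /= in vu uv nu nv.
exists (cmp (u Y) (cmp (fmap G h) (v X))); apply: faithG.
rewrite -[LHS]cmp1m -(vu Y) -cmpA nu !cmpA vu cmp1m.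
by rewrite -cmpA vu cmpm1.
Qed.

Lemma equivalence_epi X Y (f : mor X Y) : epimorphism f -> epimorphism (fmap F f).
Proof.
have [u [v [vu uv nu nv]]] := natural_iso_inverse FG.1; rewrite /= in vu uv nu nv.
move=> epif Z a b eab; apply: faithG.
rewrite -[LHS]cmpm1 -[RHS]cmpm1 -vu !cmpA; congr cmp; apply: epif.
by rewrite -!cmpA nv !cmpA -!fmapM eab.
Qed.

(** F (G f) is a conjugate of f, hence additive in f, and F is additive and faithful. *)
Lemma inverse_additive : additive_functor F -> additive_functor G.
Proof.
have [u [v [vu uv nu nv]]] := natural_iso_inverse FG.2; rewrite /= in vu uv nu nv.
have FGE X Y (f : mor X Y) : fmap F (fmap G f) = cmp (v Y) (cmp f (u X)).
  by rewrite -nu cmpA vu cmp1m.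
move=> addF X Y f g; apply: faithF.
by rewrite addF !FGE cmpDl cmpDr.
Qed.

(** A family into F X is carried by G, followed by u, to a family into X; the finite set of indices
    found there also serves for F X. *)
Lemma compact_equivalence X : compact_object X -> compact_object (F X).
Proof.
have [u [v [vu uv nu nv]]] := natural_iso_inverse FG.1; rewrite /= in vu uv nu nv.
move=> cX I Y f jf.
have [|s js] := cX I (fun i => G (Y i)) (fun i => cmp (u X) (fmap G (f i))).
  move=> Z a b eab; apply: faithF; apply: jf => i _; apply: faithG.
  by rewrite !fmapM -[LHS]cmp1m -[RHS]cmp1m -vu -!cmpA 2!(cmpA (u Z)) !nu -!cmpA eab.
exists s => Z a b eab; apply: faithG.
rewrite -[LHS]cmpm1 -[RHS]cmpm1 -vu !cmpA; congr cmp; apply: js => i si.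
by rewrite -!cmpA !(cmpA (v X)) vu cmp1m -!fmapM eab.
Qed.

End Equivalences.

(** The lifting problem is carried by G to one for P and solved there; the solution comes back
    because G is full. *)
Lemma projective_equivalence C D (F : functor C D) (G : functor D C) P :
  mutually_inverse F G -> projective P -> projective (F P).
Proof.
move=> FG projP X Y g epig f.
have [u [v [vu uv nu nv]]] := natural_iso_inverse FG.1; rewrite /= in vu uv nu nv.
have GF := mutually_inverse_sym FG.
have [h hE] := projP _ _ _ (equivalence_epi GF epig) (cmp (fmap G f) (v P)).
have [k kE] := equivalence_full GF (cmp h (u P)).
exists k; apply: (faithful_left_inverse FG.2).
by rewrite fmapM kE cmpA hE -cmpA vu cmpm1.
Qed.

(** The last clause lets finite generation of F' X be read off from F. *)
Lemma full_subcategory_equivalence C D (F : functor C D) (G : functor D C)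
    (P : C -> Prop) (Q : D -> Prop) :
  mutually_inverse F G -> additive_functor F ->
  (forall X, P X -> Q (F X)) -> (forall Y, Q Y -> P (G Y)) ->
  exists F' : functor (full_subcategory P) (full_subcategory Q),
    [/\ additive_functor F', equivalence F' & forall X, sval (F' X) = F (sval X)].
Proof.
move=> [[u [iu nu]] [w [iw nw]]] addF PQ QP.
pose F' : functor (full_subcategory P) (full_subcategory Q) :=
  @Functor (full_subcategory P) (full_subcategory Q)
    (fun X => exist _ (F (sval X)) (PQ _ (svalP X)))
    (fun X Y f => @fmap _ _ F (sval X) (sval Y) f)
    (fun X => fmap1 F (sval X)) (fun X Y Z g f => fmapM F g f).
pose G' : functor (full_subcategory Q) (full_subcategory P) :=
  @Functor (full_subcategory Q) (full_subcategory P)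
    (fun X => exist _ (G (sval X)) (QP _ (svalP X)))
    (fun X Y f => @fmap _ _ G (sval X) (sval Y) f)
    (fun X => fmap1 G (sval X)) (fun X Y Z g f => fmapM G g f).
exists F'; split=> //; first by move=> X Y f g; apply: addF.
exists G'; split.
  by exists (fun X => u (sval X)); split=> [X|X Y f]; [apply: iu | apply: nu].
by exists (fun X => w (sval X)); split=> [X|X Y f]; [apply: iw | apply: nw].
Qed.

(** * Restricting an equivalence to smaller full subcategories *)

Section FullSubcategories.
Variables (C D : preadditive) (P P' : C -> Prop) (Q Q' : D -> Prop).
Hypotheses (PP : forall X, P' X -> P X) (QQ : forall Y, Q' Y -> Q Y).

Definition shrink_obj (X : full_subcategory P') : full_subcategory P :=
  exist _ (sval X) (PP (svalP X)).

Definition shrink (F : functor (full_subcategory P) (full_subcategory Q))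
    (FP : forall X, P' (sval X) -> Q' (sval (F X))) :
    functor (full_subcategory P') (full_subcategory Q') :=
  @Functor (full_subcategory P') (full_subcategory Q')
    (fun X => exist _ (sval (F (shrink_obj X))) (FP (shrink_obj X) (svalP X)))
    (fun X Y f => @fmap _ _ F (shrink_obj X) (shrink_obj Y) f)
    (fun X => fmap1 F (shrink_obj X))
    (fun X Y Z g f => @fmapM _ _ F (shrink_obj X) (shrink_obj Y) (shrink_obj Z) g f).

End FullSubcategories.

Lemma shrink_left_inverse (C D : preadditive) (P P' : C -> Prop)
    (Q Q' : D -> Prop) (PP : forall X, P' X -> P X) (QQ : forall Y, Q' Y -> Q Y)
    (F : functor (full_subcategory P) (full_subcategory Q))
    (G : functor (full_subcategory Q) (full_subcategory P))
    (FP : forall X, P' (sval X) -> Q' (sval (F X)))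
    (GQ : forall Y, Q' (sval Y) -> P' (sval (G Y))) :
  naturally_isomorphic (functor_comp G F) (functor_id _) ->
  naturally_isomorphic
    (functor_comp (shrink QQ GQ) (shrink PP FP))
    (functor_id (full_subcategory P')).
Proof.
move=> /natural_iso_inverse[u [v [vu uv nu nv]]].
have {}vu X : cmp (v X) (u X) = idm (G (F X)) := vu X.
have {}uv X : cmp (u X) (v X) = idm X := uv X.
have {}nu X Y (f : mor X Y) : cmp (u Y) (fmap G (fmap F f)) = cmp f (u X) := nu X Y f.
pose i (X : full_subcategory P') := shrink_obj PP X.
pose FX X : full_subcategory Q := shrink_obj QQ (shrink PP FP X).
(* FX X and F (i X) differ only in the proof component: a and b are identities *)
pose a X : @mor (full_subcategory P) (G (FX X)) (G (F (i X))) :=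
  @fmap _ _ G (FX X) (F (i X)) (@idm (full_subcategory Q) (FX X)).
pose b X : @mor (full_subcategory P) (G (F (i X))) (G (FX X)) :=
  @fmap _ _ G (F (i X)) (FX X) (@idm (full_subcategory Q) (FX X)).
have ba X : cmp (b X) (a X) = idm _.
  by rewrite -fmapM -fmap1; congr (fmap G _); apply: (cmp1m (idm (FX X))).
have ab X : cmp (a X) (b X) = idm _.
  by rewrite -fmapM -fmap1; congr (fmap G _); apply: (cmp1m (idm (FX X))).
have bvua X : cmp (cmp (b X) (v (i X))) (cmp (u (i X)) (a X)) = idm _.
  by rewrite -cmpA (cmpA (v _)) vu cmp1m ba.
have uabv X : cmp (cmp (u (i X)) (a X)) (cmp (b X) (v (i X))) = idm _.
  by rewrite -cmpA (cmpA (a _)) ab cmp1m uv.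
have aG (X Y : full_subcategory P') (f : mor X Y) :
    cmp (a Y) (@fmap _ _ G (FX X) (FX Y) (@fmap _ _ F (i X) (i Y) f)) =
    cmp (fmap G (fmap F (f : mor (i X) (i Y)))) (a X).
  rewrite -!fmapM; congr (fmap G _).
  exact: etrans (cmp1m _) (esym (cmpm1 _)).
exists (fun X => cmp (u (i X)) (a X)); split=> [X|X Y f].
  by exists (cmp (b X) (v (i X))); split; [apply: bvua | apply: uabv].
have nua : cmp (cmp (u (i Y)) (a Y))
    (@fmap _ _ G (FX X) (FX Y) (@fmap _ _ F (i X) (i Y) f)) =
    cmp (f : mor (i X) (i Y)) (cmp (u (i X)) (a X)).
  by rewrite -cmpA aG !cmpA nu.
exact: nua.
Qed.

Lemma full_subcategory_shrink (C D : preadditive) (P P' : C -> Prop) (Q Q' : D -> Prop)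
    (F : functor (full_subcategory P) (full_subcategory Q))
    (G : functor (full_subcategory Q) (full_subcategory P)) :
  mutually_inverse F G -> additive_functor F ->
  (forall X, P' X -> P X) -> (forall Y, Q' Y -> Q Y) ->
  (forall X, P' (sval X) -> Q' (sval (F X))) ->
  (forall Y, Q' (sval Y) -> P' (sval (G Y))) ->
  exists F' : functor (full_subcategory P') (full_subcategory Q'),
    additive_functor F' /\ equivalence F'.
Proof.
move=> [GF FG] addF PP QQ FP GQ; exists (shrink PP FP); split.
  by move=> X Y f g; apply: addF.
by exists (shrink QQ GQ); split; apply: shrink_left_inverse.
Qed.

Lemma full_subcategory_iso (C : preadditive) (P : C -> Prop)
    (X Y : full_subcategory P) (f : mor X Y) :
  isomorphism f -> @isomorphism C (sval X) (sval Y) f.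
Proof. by []. Qed.

(** * Submodules and quotients *)

Section Subgroups.
Variable V : zmodType.

Record subgroup := Subgroup {
  subgroup_set :> V -> Prop;
  subgroup0 : subgroup_set 0;
  subgroupB : forall x y, subgroup_set x -> subgroup_set y -> subgroup_set (x - y) }.

(** Boolean reflection of the subgroup, the form from which subtypes and quotients are built. *)
Definition subgroup_pred (N : subgroup) : pred V := fun x => `[< N x >].

Lemma subgroup_zmod_closed N : zmod_closed (subgroup_pred N).
Proof.
split; first by apply/asboolP/subgroup0.
by move=> x y /asboolP Nx /asboolP Ny; apply/asboolP/subgroupB.
Qed.

HB.instance Definition _ N :=
  GRing.isZmodClosed.Build V (subgroup_pred N) (subgroup_zmod_closed N).

Record subgroup_elt (N : subgroup) := SubgroupElt {
  subgroup_val :> V;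
  subgroup_valP : subgroup_pred N subgroup_val }.

HB.instance Definition _ N := [isSub for @subgroup_val N].
HB.instance Definition _ N := [Choice of subgroup_elt N by <:].
HB.instance Definition _ N := [SubChoice_isSubZmodule of subgroup_elt N by <:].

Definition to_subgroup (N : subgroup) x (Nx : N x) : subgroup_elt N :=
  SubgroupElt (asboolT Nx : subgroup_pred N x).

Lemma subgroup_eltP (N : subgroup) (x : subgroup_elt N) : N x.
Proof. by case: x => x /= /asboolP. Qed.

Lemma subgroup_val_inj N : injective (@subgroup_val N).
Proof. exact: val_inj. Qed.

End Subgroups.

Section Submodules.
Variables (R : rng) (M : lmodule R).

Lemma act_sum r (I : Type) (s : seq I) (F : I -> M) :
  act r (\sum_(i <- s) F i) = \sum_(i <- s) act r (F i).
Proof. by elim/big_rec2: _ => [|i y x _ <-]; rewrite ?act0r ?actDr. Qed.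

Lemma act0l (x : M) : act 0 x = 0.
Proof. by apply: (addrI (act 0 x)); rewrite -actDl !addr0. Qed.

Section Quotient.
Variables (N : set M) (subN : submodule N).

Definition submodule_subgroup : subgroup M :=
  let: And3 N0 NB _ := subN in Subgroup N0 NB.

Lemma submodule_subgroupE x : submodule_subgroup x = N x.
Proof. by rewrite /submodule_subgroup; case: subN. Qed.

Local Notation T :=
  {ideal_quot (GRing.ZmodClosed.clone M (subgroup_pred submodule_subgroup) _)}.

Lemma quotient_eq (x y : M) : \pi_T x = \pi_T y <-> N (x - y).
Proof.
rewrite -submodule_subgroupE; split=> [/eqP|Nxy].
  by rewrite -Quotient.idealrBE => /asboolP.
by apply/eqP; rewrite -Quotient.idealrBE; apply/asboolP.
Qed.

Lemma quotient_piD : {morph \pi_T : x y / x + y}.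
Proof. by move=> x y; rewrite !piE. Qed.

Lemma quotient_pi0 : \pi_T 0 = 0.
Proof. by rewrite !piE. Qed.

Definition quotient_act (r : R) (x : T) : T := \pi_T (act r (repr x)).

Lemma quotient_actE r x : quotient_act r (\pi_T x) = \pi_T (act r x).
Proof.
case: (subN) => _ _ Nact; apply/quotient_eq; rewrite -actBr; apply: Nact.
by apply/quotient_eq; rewrite reprK.
Qed.

Definition quotient_module : lmodule R.
Proof.
refine (@LModule R T quotient_act _ _ _).
- by move=> r s x; rewrite [quotient_act s x]/quotient_act quotient_actE actA.
- by move=> r s x; rewrite /quotient_act actDl quotient_piD.
- move=> r x y; rewrite -[x in LHS]reprK -[y in LHS]reprK -quotient_piD.
  by rewrite quotient_actE actDr quotient_piD.
Defined.

Lemma quotient_pi_linear : @linear_homb R M quotient_module \pi_T.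
Proof. by apply/asboolP; split=> [x y|r x]; rewrite ?quotient_piD //= quotient_actE. Qed.

Definition quotient_pi : module_hom M quotient_module := ModuleHom quotient_pi_linear.

Lemma quotient_pi_eq0 x : quotient_pi x = 0 <-> N x.
Proof. by rewrite -[in N x](subr0 x) -quotient_eq quotient_pi0. Qed.

Lemma quotient_unitary : unitary M -> unitary quotient_module.
Proof.
move=> uM x; have [s sx] := uM (repr x); exists [seq (p.1, \pi_T p.2) | p <- s].
rewrite -[LHS]reprK sx (big_morph _ quotient_piD quotient_pi0) big_map.
apply: eq_bigr => p _ /=.
by rewrite quotient_actE.
Qed.

End Quotient.
End Submodules.

(** * Generation, epimorphisms and compactness in RMod *)

Section SubmoduleLattice.
Variable R : rng.

Lemma module_hom0 (M N : lmodule R) (f : module_hom M N) : f 0 = 0.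
Proof. by apply: (addrI (f 0)); rewrite -module_hom_add !addr0. Qed.

Lemma module_homB (M N : lmodule R) (f : module_hom M N) x y :
  f (x - y) = f x - f y.
Proof. by apply: (addIr (f y)); rewrite -module_hom_add !subrK. Qed.

Lemma module_hom_sum (M N : lmodule R) (f : module_hom M N) (I : Type)
    (s : seq I) (x : I -> M) :
  f (\sum_(i <- s) x i) = \sum_(i <- s) f (x i).
Proof. exact: (big_morph f (module_hom_add f) (module_hom0 f)). Qed.

Lemma hom_sumE (M N : lmodule R) (I : Type) (s : seq I)
    (f : I -> module_hom M N) (x : M) :
  (\sum_(i <- s) f i : module_hom M N) x = \sum_(i <- s) f i x.
Proof. exact: (big_morph (fun h : module_hom M N => h x)). Qed.

Lemma submodule_equalizer (M N : lmodule R) (g h : module_hom M N) :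
  submodule [set x | g x = h x].
Proof.
split=> [|x y /= gx gy|r x /= gx] /=; last by rewrite !module_hom_act gx.
  by rewrite !module_hom0.
by rewrite !module_homB gx gy.
Qed.

Lemma submodule_range (M N : lmodule R) (g : module_hom M N) :
  submodule (range g).
Proof.
split=> [|_ _ [x _ <-] [y _ <-]|r _ [x _ <-]].
- by exists 0 => //; rewrite module_hom0.
- by exists (x - y) => //; rewrite module_homB.
- by exists (act r x) => //; rewrite module_hom_act.
Qed.

Definition submodule_span (M : lmodule R) (A : set M) : set M :=
  [set x | forall N, submodule N -> A `<=` N -> N x].

Lemma submodule_spanP (M : lmodule R) (A : set M) : submodule (submodule_span A).
Proof.
split=> [N sN _|x y xA yA N sN AN|r x xA N sN AN]; case: (sN) => N0 NB Nact //.
  by apply: NB; [apply: xA | apply: yA].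
by apply: Nact; apply: xA.
Qed.

Lemma submodule_span_mono (M : lmodule R) (A B : set M) :
  A `<=` B -> submodule_span A `<=` submodule_span B.
Proof. by move=> AB x xA N sN BN; apply: xA => // y /AB/BN. Qed.

Lemma jointly_epi_total I (A : I -> Prop) (M : RMod R) (X : I -> RMod R)
    (f : forall i, mor (X i) M) (N : set (RMod_module M)) :
  jointly_epi A f -> submodule N ->
  (forall i x, A i -> N ((f i : module_hom _ _) x)) -> N = [set: RMod_module M].
Proof.
move=> jf sN fN.
(* the quotient map and the zero map M -> M / N agree on every f i *)
pose Q : RMod R := exist _ _ (quotient_unitary (subN := sN) (svalP M)).
have pi0 : quotient_pi sN = 0 :> mor M Q.
  apply: jf => i Ai; apply: module_hom_ext => x.
  by apply/(quotient_pi_eq0 sN); apply: fN.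
apply/seteqP; split=> // x _; apply/(quotient_pi_eq0 sN).
by rewrite pi0.
Qed.

(** The equalizer of g and h is a submodule containing all the images, hence their span. *)
Lemma jointly_epi_of_total I (A : I -> Prop) (M : RMod R) (X : I -> RMod R)
    (f : forall i, mor (X i) M) :
  submodule_span [set y | exists i x, A i /\ y = (f i : module_hom _ _) x]
    = [set: RMod_module M] ->
  jointly_epi A f.
Proof.
move=> tot Z g h egh; apply: module_hom_ext => y.
have : [set: RMod_module M] y by [].
rewrite -tot => /(_ _ (submodule_equalizer g h)); apply=> _ [i [x [Ai ->]]].
by have := congr1 (fun k : module_hom _ _ => k x) (egh i Ai).
Qed.

(** An epimorphism is a jointly epimorphic family with one member, and its range is a submodule
    containing the image. *)
Lemma epi_surjective (X Y : RMod R) (g : mor X Y) :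
  epimorphism g -> forall y, exists x, (g : module_hom _ _) x = y.
Proof.
move=> epig y.
have jg : jointly_epi setT (fun _ : unit => g) by move=> Z a b /(_ tt I)/epig.
have : [set: RMod_module Y] y by [].
rewrite -(jointly_epi_total jg (submodule_range g)) => [[x _ <-]|_ x _]; by exists x.
Qed.

Lemma surjective_epi (X Y : RMod R) (g : mor X Y) :
  (forall y, exists x, (g : module_hom _ _) x = y) -> epimorphism g.
Proof.
move=> sg Z a b eab; apply: module_hom_ext => y; have [x <-] := sg y.
exact: (congr1 (fun k : module_hom _ _ => k x) eab).
Qed.

(** The spans of the finite subfamilies form a directed system, so their union is a submodule, and
    it is all of M. A finite generating set therefore already lies in one of these spans. *)
Lemma fg_compact (M : RMod R) :
  finitely_generated (RMod_module M) -> compact_object M.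
Proof.
move=> [s gens] I X f jf.
pose B (L : seq I) : set (RMod_module M) :=
  [set y | exists i x, i \in L /\ y = (f i : module_hom _ _) x].
have BM L L' : {subset L <= L'} -> submodule_span (B L) `<=` submodule_span (B L').
  by move=> LL; apply: submodule_span_mono => _ [i [x [/LL iL ->]]]; exists i, x.
have tot : [set y | exists L, submodule_span (B L) y] = [set: RMod_module M].
  apply: (jointly_epi_total jf) => [|i x _].
    split=> [|x y [L xL] [L' yL]|r x [L xL]].
    - by exists [::]; case: (submodule_spanP (B [::])).
    - exists (L ++ L'); case: (submodule_spanP (B (L ++ L'))) => _ NB _; apply: NB.
        by apply: BM xL => i; rewrite mem_cat => ->.
      by apply: BM yL => i; rewrite mem_cat orbC => ->.
    - by exists L; case: (submodule_spanP (B L)) => _ _; apply.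
  by exists [:: i] => N _; apply; exists i, x; rewrite mem_head.
suff [L sL] : exists L, [set` s] `<=` submodule_span (B L).
  by exists L; apply: jointly_epi_of_total; apply: gens sL; apply: submodule_spanP.
elim: s {gens} => [|x s [L sL]]; first by exists [::].
have [L' xL'] : exists L, submodule_span (B L) x.
  by have : [set: RMod_module M] x by []; rewrite -tot.
exists (L' ++ L) => y /=; rewrite inE => /orP[/eqP->|ys].
  by apply: BM xL' => i; rewrite mem_cat => ->.
by apply: BM (sL _ ys) => i; rewrite mem_cat orbC => ->.
Qed.

End SubmoduleLattice.

(** * Local units on unitary modules and the regular module *)

Section LocalUnits.
Variable R : rng.

(** Each entry of s is a finite sum of products r m; a local unit for all the coefficients r fixes
    every entry. *)
Lemma unitary_local_unit (M : lmodule R) : has_local_units R -> unitary M ->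
  forall s : seq M, exists e : R, rmul e e = e /\ forall x, x \in s -> act e x = x.
Proof.
move=> hR uM s.
have [rs rsP] : exists rs : seq R, forall e : R,
    (forall r, r \in rs -> rmul e r = r) -> forall x, x \in s -> act e x = x.
  elim: s => [|y s [rs rsP]]; first by exists [::].
  have [t ->] := uM y; exists ([seq p.1 | p <- t] ++ rs) => e eP x.
  rewrite inE => /orP[/eqP->|]; last first.
    by apply: rsP => r rrs; apply: eP; rewrite mem_cat rrs orbT.
  rewrite act_sum big_seq [RHS]big_seq; apply: eq_bigr => p pt.
  by rewrite actA eP // mem_cat map_f.
have [e [ee es]] := hR rs; exists e; split=> //; apply: rsP => r rrs.
have [a _ <-] := es r rrs.
by rewrite !rmulA ee.
Qed.

Definition regular : lmodule R :=
  @LModule R R (@rmul R) (@rmulA R) (@rmulDl R) (@rmulDr R).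

Lemma regular_unitary : has_local_units R -> unitary regular.
Proof.
move=> hR x; have [e [ee es]] := hR [:: x].
have [|a _ xE] := es x; first exact: mem_head.
exists [:: (e, x)]; rewrite big_seq1 /= -xE.
by rewrite !rmulA ee.
Qed.

Definition right_mul (M : lmodule R) (x : M) (r : R) : M := act r x.

Lemma right_mul_linear (M : lmodule R) (x : M) :
  @linear_homb R regular M (right_mul x).
Proof.
by apply/asboolP; split=> [r s|r s]; rewrite /right_mul ?actDl // actA.
Qed.

Definition right_mul_hom (M : lmodule R) (x : M) : module_hom regular M :=
  ModuleHom (right_mul_linear x).

(** The maps r |-> r x from R to M, one for each x in M, are jointly epimorphic because x = e x for
    some e. The x that index a finite jointly epimorphic subfamily generate M. *)
Lemma compact_fg (M : RMod R) : has_local_units R ->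
  compact_object M -> finitely_generated (RMod_module M).
Proof.
move=> hR cM; pose X : RMod R := exist _ _ (regular_unitary hR).
pose f (x : RMod_module M) : mor X M := right_mul_hom x.
have [|s js] := cM _ (fun=> X) f.
  move=> Z g h egh; apply: module_hom_ext => x.
  have [e [_ /(_ x (mem_head _ _)) <-]] :=
    unitary_local_unit hR (svalP M) [:: x].
  exact: (congr1 (fun k : module_hom regular (RMod_module Z) => k e) (egh x _)).
exists s => N sN Ns; apply: (jointly_epi_total js sN) => x r xs.
by case: sN => _ _; apply; apply: Ns.
Qed.

Lemma fg_iso (M N : RMod R) (f : mor M N) :
  isomorphism f -> finitely_generated (RMod_module M) ->
  finitely_generated (RMod_module N).
Proof.
move=> [g [gf fg]] [s sgen]; exists [seq (f : module_hom _ _) x | x <- s].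
move=> L [L0 LB Lact] sL; apply/seteqP; split=> // y _.
have <- : (f : module_hom _ _) ((g : module_hom _ _) y) = y.
  exact: (congr1 (fun k : module_hom _ _ => k y) fg).
have : [set: RMod_module M] ((g : module_hom _ _) y) by [].
rewrite -(sgen [set x | L ((f : module_hom _ _) x)]) // => [|x xs].
  split=> [|x z xL zL|r x xL] /=.
  - by rewrite module_hom0.
  - by rewrite module_homB; apply: LB.
  - by rewrite module_hom_act; apply: Lact.
by apply: sL; apply: map_f.
Qed.

End LocalUnits.

(** * The projectives Re and dual bases *)

Section LeftIdeals.
Variable R : rng.

Definition idempotent := {e : R | rmul e e = e}.

(** For an idempotent e this set is Re. *)
Lemma left_ideal_submodule (e : R) : submodule [set s : regular R | rmul s e = s].
Proof.
split=> [|x y /= xe ye|r x /= xe]; first exact: (@act0l R (regular R) e).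
  have -> : rmul (x - y) e = right_mul_hom (e : regular R) (x - y) by [].
  by rewrite module_homB /= /right_mul /= xe ye.
by rewrite -rmulA xe.
Qed.

Definition left_ideal_subgroup (e : R) : subgroup R :=
  submodule_subgroup (left_ideal_submodule e).

Definition left_ideal_act (e : R) (r : R) (x : subgroup_elt (left_ideal_subgroup e)) :
    subgroup_elt (left_ideal_subgroup e).
Proof.
apply: (@to_subgroup _ _ (rmul r (subgroup_val x))).
have := subgroup_eltP x; rewrite /left_ideal_subgroup !submodule_subgroupE /=.
by move=> xe; rewrite -rmulA xe.
Defined.

Definition left_ideal (e : R) : lmodule R.
Proof.
refine (@LModule R (subgroup_elt (left_ideal_subgroup e)) (@left_ideal_act e) _ _ _).
- by move=> r s x; apply: subgroup_val_inj; apply: rmulA.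
- by move=> r s x; apply: subgroup_val_inj; apply: rmulDl.
- by move=> r x y; apply: subgroup_val_inj; apply: rmulDr.
Defined.

Definition ideal_val (e : R) (x : left_ideal e) : R := subgroup_val x.

Lemma ideal_valP (e : R) (x : left_ideal e) : rmul (ideal_val x) e = ideal_val x.
Proof. by have := subgroup_eltP x; rewrite /left_ideal_subgroup submodule_subgroupE. Qed.

Lemma ideal_val_inj (e : R) : injective (@ideal_val e).
Proof. exact: subgroup_val_inj. Qed.

Lemma ideal_valD (e : R) (x y : left_ideal e) :
  ideal_val (x + y) = ideal_val x + ideal_val y.
Proof. by []. Qed.

Lemma ideal_val_act (e : R) r (x : left_ideal e) :
  ideal_val (act r x) = rmul r (ideal_val x).
Proof. by []. Qed.

Lemma ideal_gen_subproof (e : idempotent) : left_ideal_subgroup (sval e) (sval e).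
Proof. by rewrite /left_ideal_subgroup submodule_subgroupE /= (svalP e). Qed.

Definition ideal_gen (e : idempotent) : left_ideal (sval e) :=
  to_subgroup (ideal_gen_subproof e).

Lemma ideal_genE (e : idempotent) : ideal_val (ideal_gen e) = sval e.
Proof. by []. Qed.

Lemma act_ideal_gen (e : idempotent) (x : left_ideal (sval e)) :
  act (ideal_val x) (ideal_gen e) = x.
Proof. by apply: ideal_val_inj; rewrite ideal_val_act ideal_genE ideal_valP. Qed.

Definition ideal_mul (e : R) (M : lmodule R) (m : M) (x : left_ideal e) : M :=
  act (ideal_val x) m.

Lemma ideal_mul_linear (e : R) (M : lmodule R) (m : M) :
  linear_homb (@ideal_mul e M m).
Proof.
apply/asboolP; rewrite /ideal_mul; split=> [x y|r x].
  by rewrite ideal_valD actDl.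
by rewrite ideal_val_act actA.
Qed.

(** The element e m of eM, seen in Hom(Re, M) when e is idempotent. *)
Definition ideal_hom (e : R) (M : lmodule R) (m : M) :
  module_hom (left_ideal e) M := ModuleHom (ideal_mul_linear e m).

Lemma ideal_homE (e : R) (M : lmodule R) (m : M) x :
  ideal_hom e m x = act (ideal_val x) m.
Proof. by []. Qed.

Lemma ideal_unitary (e : idempotent) : unitary (left_ideal (sval e)).
Proof.
move=> x; exists [:: (ideal_val x, ideal_gen e)].
by rewrite big_seq1 act_ideal_gen.
Qed.

Definition ideal_mod (e : idempotent) : RMod R := exist _ _ (@ideal_unitary e).

(** Lift the image of the generator e to some x in X; then s |-> s x lifts f, because s e = s on
    Re. *)
Lemma ideal_projective (e : idempotent) : projective (ideal_mod e).
Proof.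
move=> X Y g epig f.
have [x gx] := epi_surjective epig ((f : module_hom _ _) (ideal_gen e)).
exists (ideal_hom (sval e) x); apply: module_hom_ext => s.
apply: etrans (module_hom_act (g : module_hom _ _) _ _) _.
by rewrite gx -module_hom_act act_ideal_gen.
Qed.

Lemma ideal_fg (e : idempotent) : finitely_generated (left_ideal (sval e)).
Proof.
exists [:: ideal_gen e] => N [N0 NB Nact] eN; apply/seteqP; split=> // x _.
by rewrite -[x]act_ideal_gen; apply: Nact; apply: eN; rewrite /= mem_head.
Qed.

Definition ideal_proj (e : idempotent) : projMod R :=
  exist _ (ideal_mod e) (conj (@ideal_projective e) (@ideal_fg e)).

Definition proj_module (P : projMod R) : lmodule R := RMod_module (sval P).

End LeftIdeals.

Section DualBasis.
Variables (R : rng) (hR : has_local_units R).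

Definition power_act (I : Type) (M : lmodule R) (r : R) (x : I -> M) : I -> M :=
  fun i => act r (x i).

Definition power_module (I : Type) (M : lmodule R) : lmodule R.
Proof.
refine (@LModule R (I -> M) (@power_act I M) _ _ _).
- by move=> r s x; apply: funext => i; apply: actA.
- by move=> r s x; apply: funext => i; apply: actDl.
- by move=> r x y; apply: funext => i; apply: actDr.
Defined.

(** One local unit e fixes the finitely many coordinates at once, so x = e x. *)
Lemma power_unitary n (M : lmodule R) : unitary M -> unitary (power_module 'I_n M).
Proof.
move=> uM x; have [e [_ ex]] := unitary_local_unit hR uM [seq x i | i <- enum 'I_n].
exists [:: (e, x)]; rewrite big_seq1 /=; apply: funext => i /=.
by rewrite /power_act ex //; apply: map_f; rewrite mem_enum.
Qed.

Lemma local_unit_family (M : lmodule R) n (p : 'I_n -> M) : unitary M ->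
  exists g : idempotent R, forall i, act (sval g) (p i) = p i.
Proof.
move=> uM; have [e [ee ep]] := unitary_local_unit hR uM [seq p i | i <- enum 'I_n].
exists (exist (fun e => rmul e e = e) e ee) => i /=.
by rewrite ep //; apply: map_f; rewrite mem_enum.
Qed.

Lemma local_unit1 (M : lmodule R) (x : M) : unitary M ->
  exists g : idempotent R, act (sval g) x = x.
Proof.
move=> uM; have [g gx] := local_unit_family (fun _ : 'I_1 => x) uM.
by exists g; apply: (gx ord0).
Qed.

(** One idempotent g fixes all the generators, so that x |-> sum of x_i p_i maps the power (Rg)^n
    onto P. Projectivity gives a section, and the a_i are its coordinates. *)
Lemma dual_basis (P : projMod R) :
  exists (n : nat) (g : idempotent R) (p : 'I_n -> proj_module P)
    (a : 'I_n -> module_hom (proj_module P) (left_ideal (sval g))),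
  forall x, x = \sum_(i < n) act (ideal_val (a i x)) (p i).
Proof.
case: P => [[M uM] [/= projM [s sgen]]]; rewrite /proj_module /=.
pose p (i : 'I_(size s)) := tnth (in_tuple s) i.
have [g gp] := local_unit_family p uM.
pose L := power_module 'I_(size s) (left_ideal (sval g)).
pose f (x : L) : M := \sum_i act (ideal_val (x i)) (p i).
have flin : linear_homb f.
  apply/asboolP; split=> [x y|r x].
    by rewrite /f -big_split; apply: eq_bigr => i _; apply: actDl.
  by rewrite /f act_sum; apply: eq_bigr => i _; apply/esym/actA.
pose X : RMod R := exist _ L (power_unitary (@ideal_unitary _ g)).
have [|h hE] := projM X (exist _ M uM) (ModuleHom flin) _ (module_id M).
  apply: surjective_epi => y.
  have : [set: M] y by [].
  rewrite -(sgen _ (submodule_range (ModuleHom flin))) =>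
    [[x _ <-]|_ /(tnthP (in_tuple s))[i ->]].
    by exists x.
  (* This tuple is sent to g p_i, which is p_i. *)
  exists (fun j => if j == i then ideal_gen g else 0) => //=.
  rewrite /f (bigD1 i) //= eqxx big1 ?addr0; first exact: gp.
  by move=> j /negPf->; apply: act0l.
have alin i : linear_homb (fun x => (h : module_hom M L) x i).
  apply/asboolP; split=> [x y|r x].
    by rewrite (module_hom_add (h : module_hom M L)).
  by rewrite (module_hom_act (h : module_hom M L)).
exists (size s), g, p, (fun i => ModuleHom (alin i)) => x.
exact: esym (congr1 (fun k : module_hom M M => k x) hE).
Qed.

End DualBasis.

(** * Extending a functor between finitely generated projectives *)

Section Extension.
Variables (R S : rng) (hS : has_local_units S).
Variables (G : functor (projMod S) (projMod R)) (addG : additive_functor G).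

(** [fmap] with the types of module homomorphisms, so that the result can be applied to elements. *)
Definition fmap_hom (P Q : projMod S) (h : module_hom (proj_module P) (proj_module Q)) :
  module_hom (proj_module (G P)) (proj_module (G Q)) := @fmap _ _ G P Q h.

Lemma fmap_hom_comp (P Q T : projMod S)
    (k : module_hom (proj_module Q) (proj_module T))
    (h : module_hom (proj_module P) (proj_module Q)) :
  fmap_hom (module_comp k h) = module_comp (fmap_hom k) (fmap_hom h).
Proof. exact: (@fmapM _ _ G P Q T k h). Qed.

Lemma fmap_hom_id (P : projMod S) : fmap_hom (module_id (proj_module P)) = module_id _.
Proof. exact: (@fmap1 _ _ G P). Qed.

Lemma fmap_homD (P Q : projMod S) :
  {morph @fmap_hom P Q : h k / h + k}.
Proof. exact: (@addG P Q). Qed.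

Lemma fmap_hom_sum (P Q : projMod S) (I : Type) (s : seq I)
    (h : I -> module_hom (proj_module P) (proj_module Q)) :
  fmap_hom (\sum_(i <- s) h i) = \sum_(i <- s) fmap_hom (h i).
Proof.
apply: (big_morph _ (@fmap_homD P Q)).
by apply: (addrI (fmap_hom 0)); rewrite -fmap_homD !addr0.
Qed.

Definition gen_image (e : idempotent S) : lmodule R := proj_module (G (ideal_proj e)).

(** The image under G of the map s |-> s p from Se to P; all maps between the G(Se) and G P that
    build the colimit have this form. *)
Definition transfer (P : projMod S) (e : idempotent S) (p : proj_module P) :
  module_hom (gen_image e) (proj_module (G P)) :=
  @fmap_hom (ideal_proj e) P (ideal_hom (sval e) p).

Lemma transferD (P : projMod S) e (p p' : proj_module P) q :
  transfer e (p + p') q = transfer e p q + transfer e p' q.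
Proof.
rewrite -module_homD /transfer -fmap_homD; congr (fmap_hom _ q).
by apply: module_hom_ext => x; rewrite module_homD !ideal_homE actDr.
Qed.

Lemma fmap_transfer (P Q : projMod S)
    (h : module_hom (proj_module P) (proj_module Q)) e (p : proj_module P) q :
  fmap_hom h (transfer e p q) = transfer e (h p) q.
Proof.
rewrite /transfer.
have -> : ideal_hom (sval e) (h p) = module_comp h (ideal_hom (sval e) p).
  by apply: module_hom_ext => x; apply/esym/(module_hom_act h).
by rewrite fmap_hom_comp.

Qed.

(** This is [fmap_transfer] for the map Sg -> P given by p, which sends s to s p. *)
Lemma transfer_transfer (P : projMod S) (g e : idempotent S) (p : proj_module P)
    (s : proj_module (ideal_proj g)) q :
  transfer g p (transfer e s q) = transfer e (act (ideal_val s) p) q.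
Proof. exact: (@fmap_transfer (ideal_proj g) P). Qed.

Lemma transfer_gen (e : idempotent S) q :
  @transfer (ideal_proj e) e (ideal_gen e) q = q.
Proof.
rewrite /transfer.
have -> : ideal_hom (sval e) (ideal_gen e) = module_id _.
  by apply: module_hom_ext => x; rewrite ideal_homE act_ideal_gen.
by rewrite (fmap_hom_id (ideal_proj e)).
Qed.

Section Object.
Variable M : lmodule R.

(** An element x of the colimit is encoded by the components of all its
    multiples: x (e, q) a is the value at q of the e-component of a x.  The action
    of t is then substitution of a t for a, and no representative is chosen. *)
Definition raw_extension := {e : idempotent S & gen_image e} -> S -> M.

(** x is represented at the index g by y in Hom(G(Sg), M): the e-component of a x is y composed with
    the image under G of s |-> s a g from Se to Sg. *)
Definition in_extension (x : raw_extension) : Prop :=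
  exists (g : idempotent S) (y : module_hom (gen_image g) M),
  forall e q a, x (existT _ e q) a =
    y (@transfer (ideal_proj g) e (act a (ideal_gen g)) q).

(** Change of representative: an element given by p in P and a map y on G P is represented at every
    index g that fixes p. With P = Sh this moves an element from the index h to a larger one. *)
Lemma in_extension_at (P : projMod S) (p : proj_module P)
    (y : module_hom (proj_module (G P)) M) (x : raw_extension) (g : idempotent S) :
  (forall e q a, x (existT _ e q) a = y (transfer e (act a p) q)) ->
  act (sval g) p = p ->
  forall e q a, x (existT _ e q) a =
    module_comp y (transfer g p)
      (@transfer (ideal_proj g) e (act a (ideal_gen g)) q).
Proof.
move=> xE gp e q a; rewrite xE /= transfer_transfer.
by rewrite ideal_val_act ideal_genE -actA gp.
Qed.

Lemma in_extensionI (P : projMod S) (p : proj_module P)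
    (y : module_hom (proj_module (G P)) M) (x : raw_extension) :
  (forall e q a, x (existT _ e q) a = y (transfer e (act a p) q)) ->
  in_extension x.
Proof.
move=> xE; have [g gp] := local_unit1 hS p (svalP (sval P)).
by exists g; exists (module_comp y (transfer g p)); apply: in_extension_at.
Qed.

Lemma in_extension0 : in_extension 0.
Proof.
have [e [ee _]] := hS [::].
by exists (exist (fun e => rmul e e = e) e ee), 0.
Qed.

(** A local unit k for both g and h is a common index, at which the two representatives can be
    subtracted. *)
Lemma in_extensionB x y : in_extension x -> in_extension y -> in_extension (x - y).
Proof.
move=> [g [u xE]] [h [v yE]].
have [e [ee ek]] := hS [:: sval g; sval h].
pose k : idempotent S := exist (fun e => rmul e e = e) e ee.
have kl r : r \in [:: sval g; sval h] -> rmul (sval k) r = r.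
  by move=> /ek[a _ <-]; rewrite !rmulA ee.
have kg : act (sval k) (ideal_gen g) = ideal_gen g.
  by apply: ideal_val_inj; apply: kl; rewrite !inE eqxx.
have kh : act (sval k) (ideal_gen h) = ideal_gen h.
  by apply: ideal_val_inj; apply: kl; rewrite !inE eqxx orbT.
have {}xE := @in_extension_at (ideal_proj g) _ _ _ _ xE kg.
have {}yE := @in_extension_at (ideal_proj h) _ _ _ _ yE kh.
by eexists k, (_ - _) => e' q a; rewrite /= !fctE xE yE.
Qed.

Definition extension_subgroup : subgroup raw_extension :=
  Subgroup in_extension0 in_extensionB.

(** Since (a t) g = a (t g), the element t g of Sg and the same y describe t x. *)
Lemma extension_act_subproof (t : S) (x : subgroup_elt extension_subgroup) :
  extension_subgroup (fun w a => subgroup_val x w (rmul a t)).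
Proof.
have [g [y xE]] := subgroup_eltP x.
apply: (@in_extensionI (ideal_proj g) (act t (ideal_gen g)) y) => e q a.
by rewrite xE actA.
Qed.

Definition extension_act (t : S) (x : subgroup_elt extension_subgroup) :=
  to_subgroup (extension_act_subproof t x).

(** Raw elements are arbitrary functions of a; being represented makes them additive, which is what
    (r + s) x = r x + s x requires. *)
Lemma extension_additive (x : subgroup_elt extension_subgroup) w a b :
  subgroup_val x w (a + b) = subgroup_val x w a + subgroup_val x w b.
Proof.
have [g [y xE]] := subgroup_eltP x.
by case: w => e q; rewrite !xE actDl transferD module_hom_add.
Qed.

Definition extension : lmodule S.
Proof.
refine (@LModule S (subgroup_elt extension_subgroup) extension_act _ _ _).
- move=> r s x; apply: subgroup_val_inj; apply: funext => w; apply: funext => a /=.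
  by rewrite rmulA.
- move=> r s x; apply: subgroup_val_inj; apply: funext => w; apply: funext => a /=.
  by rewrite rmulDr extension_additive.
- by move=> r x y; apply: subgroup_val_inj.
Defined.

Definition ext_val (x : extension) : raw_extension := subgroup_val x.

Lemma ext_valP (x : extension) : in_extension (ext_val x).
Proof. exact: (subgroup_eltP (x : subgroup_elt extension_subgroup)). Qed.

Lemma ext_inj (x y : extension) :
  (forall e q a, ext_val x (existT _ e q) a = ext_val y (existT _ e q) a) -> x = y.
Proof.
move=> xy; apply: subgroup_val_inj; apply: funext => -[e q].
by apply: funext => a; apply: xy.
Qed.

Lemma ext_valD (x y : extension) w a : ext_val (x + y) w a = ext_val x w a + ext_val y w a.
Proof. by []. Qed.

Lemma ext_val_act t (x : extension) w a : ext_val (act t x) w a = ext_val x w (rmul a t).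
Proof. by []. Qed.

Lemma ext_val_sum I (s : seq I) (x : I -> extension) w a :
  ext_val (\sum_(i <- s) x i) w a = \sum_(i <- s) ext_val (x i) w a.
Proof. exact: (big_morph (fun x => ext_val x w a)). Qed.

(** An element represented at g satisfies x = g x. *)
Lemma extension_unitary : unitary extension.
Proof.
move=> x; have [g [y xE]] := ext_valP x; exists [:: (sval g, x)].
rewrite big_seq1 /=; apply: ext_inj => e q a; rewrite ext_val_act !xE -!actA.
by rewrite [act (sval g) _](@act_ideal_gen _ g (ideal_gen g)).
Qed.

(** Compatibility of the components: along the map Se -> Sg given by s, the g-component of a x
    restricts to the e-component of s a x. *)
Lemma ext_val_transfer (x : extension) (e g : idempotent S)
    (s : proj_module (ideal_proj g)) q a :
  ext_val x (existT _ g (transfer e s q)) a =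
  ext_val x (existT _ e q) (rmul (ideal_val s) a).
Proof.
have [h [y xE]] := ext_valP x.
by rewrite !xE transfer_transfer actA.
Qed.

Lemma component_linear (x : extension) (g : idempotent S) (a : S) :
  linear_homb (fun q : gen_image g => ext_val x (existT _ g q) a).
Proof.
have [h [y xE]] := ext_valP x.
apply/asboolP; split=> [q r|t q]; rewrite !xE.
  by rewrite !module_hom_add.
by rewrite !module_hom_act.
Qed.

Definition component (x : extension) g a : module_hom (gen_image g) M :=
  ModuleHom (component_linear x g a).

(** * The bijection between Hom(G P, M) and Hom(P, GM) *)

Section Adjunct.
Variable P : projMod S.
Implicit Type phi : module_hom (proj_module (G P)) M.

Lemma adjunct_subproof phi (p : proj_module P) :
  extension_subgroup
    (fun (w : {e : idempotent S & gen_image e}) a =>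
       phi (transfer (tag w) (act a p) (tagged w))).
Proof. exact: (@in_extensionI P p phi). Qed.

Definition adjunct_fun phi (p : proj_module P) : extension :=
  to_subgroup (adjunct_subproof phi p).

Lemma adjunct_linear phi : linear_homb (adjunct_fun phi).
Proof.
apply/asboolP; split=> [p p'|r p]; apply: ext_inj => e q a.
  by rewrite ext_valD /ext_val /= actDr transferD module_hom_add.
by rewrite ext_val_act /ext_val /= actA.
Qed.

Definition adjunct phi : module_hom (proj_module P) extension :=
  ModuleHom (adjunct_linear phi).

Lemma adjunctE phi p e q a :
  ext_val (adjunct phi p) (existT _ e q) a = phi (transfer e (act a p) q).
Proof. by []. Qed.

Section DualBasis.
Variables (n : nat) (g : idempotent S) (p : 'I_n -> proj_module P)
  (b : 'I_n -> module_hom (proj_module P) (left_ideal (sval g))).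
Hypothesis pb : forall x, x = \sum_(i < n) act (ideal_val (b i x)) (p i).

(** The dual basis writes the identity of P as a sum of maps P -> Sg -> P; the additive functor G
    carries this to the identity of G P. *)
Lemma dual_basis_image (z : proj_module (G P)) :
  z = \sum_(i < n) transfer g (p i) (@fmap_hom P (ideal_proj g) (b i) z).
Proof.
rewrite -[LHS]/(module_id _ z) -fmap_hom_id.
have -> : module_id (proj_module P) =
    \sum_(i < n) module_comp (ideal_hom (sval g) (p i)) (b i).
  by apply: module_hom_ext => x; rewrite hom_sumE -pb.
rewrite fmap_hom_sum hom_sumE; apply: eq_bigr => i _.
by rewrite (@fmap_hom_comp P (ideal_proj g) P).
Qed.

(** The inverse of adjunct: z in G P is the sum of the images of the
    G(b_i)(z) in G(Sg) under G(s |-> s p_i), by dual_basis_image. *)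
Definition untranspose (y : module_hom (proj_module P) extension) :
    module_hom (proj_module (G P)) M :=
  \sum_(i < n) module_comp (component (y (p i)) g (sval g))
    (@fmap_hom P (ideal_proj g) (b i)).

(** Expanding x in the dual basis, [ext_val_transfer] matches the two sides term by term, using
    b_i(x) g = b_i(x). *)
Lemma untransposeK y : adjunct (untranspose y) = y.
Proof.
apply: module_hom_ext => x; apply: ext_inj => e q a.
rewrite adjunctE [in RHS](pb x) module_hom_sum ext_val_sum hom_sumE.
apply: eq_bigr => i _ /=.
rewrite (@fmap_transfer P (ideal_proj g)) ext_val_transfer module_hom_act.
by rewrite ideal_val_act -rmulA ideal_valP module_hom_act ext_val_act.
Qed.

End DualBasis.

Lemma adjunct_inj : injective adjunct.
Proof.
move=> phi psi epp; apply: module_hom_ext => z.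
have [n [g [p [b pb]]]] := dual_basis hS P.
rewrite (dual_basis_image pb z) !module_hom_sum; apply: eq_bigr => i _.
(* Inserting the generator g turns p_i into g p_i, the form of [adjunctE] with a = g. *)
by rewrite -[fmap_hom _ z]transfer_gen transfer_transfer -!adjunctE epp.
Qed.

Lemma adjunct_surj y : exists phi, adjunct phi = y.
Proof.
have [n [g [p [b pb]]]] := dual_basis hS P.
by exists (untranspose p b y); apply: untransposeK.
Qed.

End Adjunct.
End Object.

Lemma adjunct_naturall (M : lmodule R) (P Q : projMod S)
    (h : module_hom (proj_module P) (proj_module Q))
    (phi : module_hom (proj_module (G Q)) M) p :
  adjunct phi (h p) = @adjunct M P (module_comp phi (fmap_hom h)) p.
Proof.
by apply: ext_inj => e q a; rewrite !adjunctE /= fmap_transfer module_hom_act.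
Qed.

Section Morphism.
Variables (M N : lmodule R) (k : module_hom M N).

Lemma extension_map_subproof (x : extension M) :
  extension_subgroup N (fun w a => k (ext_val x w a)).
Proof.
have [g [y xE]] := ext_valP x.
by exists g, (module_comp k y) => e q a; rewrite xE.
Qed.

Definition extension_map_fun (x : extension M) : extension N :=
  to_subgroup (extension_map_subproof x).

Lemma ext_val_map (x : extension M) w a :
  ext_val (extension_map_fun x) w a = k (ext_val x w a).
Proof. by []. Qed.

Lemma extension_map_linear : linear_homb extension_map_fun.
Proof.
apply/asboolP; split=> [x y|r x]; apply: ext_inj => e q a.
  by rewrite ext_valD !ext_val_map -module_hom_add.
by rewrite ext_val_act !ext_val_map.
Qed.

Definition extension_map : module_hom (extension M) (extension N) :=
  ModuleHom extension_map_linear.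

Lemma adjunct_naturalr (P : projMod S) (phi : module_hom (proj_module (G P)) M) p :
  extension_map (adjunct phi p) = adjunct (module_comp k phi) p.
Proof. by apply: ext_inj. Qed.

End Morphism.

Definition extension_functor : functor (RMod R) (RMod S).
Proof.
refine (@Functor (RMod R) (RMod S)
  (fun M => exist _ (extension (sval M)) (@extension_unitary (sval M)))
  (fun M N k => extension_map (k : module_hom (sval M) (sval N))) _ _).
- by move=> M; apply: module_hom_ext => x; apply: ext_inj.
- by move=> M N T k h; apply: module_hom_ext => x; apply: ext_inj.
Defined.

Lemma extension_functor_additive : additive_functor extension_functor.
Proof. by move=> M N h k; apply: module_hom_ext => x; apply: ext_inj. Qed.

End Extension.

Lemma bijective_isomorphism (R : rng) (M N : RMod R) (f : mor M N) :
  injective (f : module_hom _ _) ->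
  (forall y, exists x, (f : module_hom _ _) x = y) -> isomorphism f.
Proof.
move=> finj fsurj; pose g y := sval (cid (fsurj y)).
have fg y : (f : module_hom _ _) (g y) = y by rewrite /g; case: cid.
have glin : linear_homb g.
  apply/asboolP; split=> [x y|r x]; apply: finj; rewrite fg.
    by rewrite module_hom_add !fg.
  by rewrite module_hom_act fg.
exists (ModuleHom glin); split; apply: module_hom_ext => x; last exact: fg.
by apply: finj; rewrite /= fg.
Qed.

(** * The natural isomorphism from M to FGM *)

Section Composite.
Variables (R S : rng) (hR : has_local_units R) (hS : has_local_units S).
Variables (F : functor (projMod R) (projMod S)) (G : functor (projMod S) (projMod R)).
Hypotheses (addF : additive_functor F) (addG : additive_functor G).
Variables (u : forall X : projMod R, mor (G (F X)) X)
  (v : forall X : projMod R, mor X (G (F X))).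
Hypotheses (vu : forall X, cmp (v X) (u X) = idm (G (F X)))
  (uv : forall X, cmp (u X) (v X) = idm X)
  (nu : forall X Y (f : mor X Y),
     cmp (u Y) (fmap G (fmap F f)) = cmp f (u X)).

Let counit (P : projMod R) : module_hom (proj_module (G (F P))) (proj_module P) := u P.
Let counit_inv (P : projMod R) : module_hom (proj_module P) (proj_module (G (F P))) := v P.

Lemma counitK P x : counit_inv P (counit P x) = x.
Proof. exact: (congr1 (fun k : module_hom _ (proj_module (G (F P))) => k x) (vu P)). Qed.

Lemma counit_invK P x : counit P (counit_inv P x) = x.
Proof. exact: (congr1 (fun k : module_hom _ (proj_module P) => k x) (uv P)). Qed.

Lemma counit_natural P Q (h : module_hom (proj_module P) (proj_module Q)) :
  module_comp (counit Q) (fmap_hom G (fmap_hom F h)) = module_comp h (counit P).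
Proof. exact: (@nu P Q h). Qed.

(** The element e m of eM = Hom(Re, M), seen in Hom(G(F(Re)), M) through the isomorphism of G(F(Re))
    with Re. *)
Let ideal_to (M : lmodule R) (e : idempotent R) (m : M) :
    module_hom (proj_module (G (F (ideal_proj e)))) M :=
  module_comp (ideal_hom (sval e) m) (counit (ideal_proj e)).

Lemma ideal_toD (M : lmodule R) e (m m' : M) :
  ideal_to e (m + m') = ideal_to e m + ideal_to e m'.
Proof. by apply: module_hom_ext => x; rewrite /= /ideal_mul actDr. Qed.

(** Naturality of the counit at the map Re -> Rg given by s. *)
Lemma ideal_to_fmap (M : lmodule R) (e g : idempotent R)
    (s : proj_module (ideal_proj g)) (m : M) :
  module_comp (ideal_to g m)
    (fmap_hom G (@fmap_hom _ _ F (ideal_proj e) (ideal_proj g)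
       (ideal_hom (sval e) s))) =
  ideal_to e (act (ideal_val s) m).
Proof.
transitivity (module_comp (ideal_hom (sval g) m)
  (module_comp (ideal_hom (sval e) s) (counit (ideal_proj e)))).
  by rewrite -(@counit_natural (ideal_proj e) (ideal_proj g)); apply: module_hom_ext.
by apply: module_hom_ext => x; rewrite /= /ideal_mul actA.
Qed.

Section Unit.
Variable M : lmodule R.
Hypothesis uM : unitary M.
Let GM := extension hS addG M.
Let FGM := extension hR addF GM.

(** The components of an element of FGM lie in Hom(F(Re), GM), which [adjunct] identifies with
    Hom(G(F(Re)), M), where [ideal_to] lands. *)
Let raw_unit (m : M) : raw_extension F GM :=
  fun w r => adjunct hS addG (ideal_to (tag w) (act r m)) (tagged w).

Lemma raw_unit_transfer (g e : idempotent R) (m : M) q (s : proj_module (ideal_proj g)) :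
  adjunct hS addG (ideal_to g m) (@transfer _ _ F (ideal_proj g) e s q) =
  adjunct hS addG (ideal_to e (act (ideal_val s) m)) q.
Proof. by rewrite /transfer adjunct_naturall ideal_to_fmap. Qed.

Lemma unit_subproof (m : M) : extension_subgroup hR F GM (raw_unit m).
Proof.
have [g gm] := local_unit1 hR m uM.
exists g, (adjunct hS addG (ideal_to g m)) => e q r.
by rewrite raw_unit_transfer ideal_val_act ideal_genE -actA gm.
Qed.

Definition unit_fun (m : M) : FGM := to_subgroup (unit_subproof m).

Lemma ext_val_unit m e q r :
  ext_val (unit_fun m) (existT _ e q) r = adjunct hS addG (ideal_to e (act r m)) q.
Proof. by []. Qed.

Lemma unit_linear : linear_homb unit_fun.
Proof.
apply/asboolP; split=> [m m'|t m]; apply: ext_inj => e q r.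
  rewrite ext_valD !ext_val_unit actDr ideal_toD; apply: ext_inj => e' q' a.
  by rewrite ext_valD !adjunctE.
by rewrite ext_val_act !ext_val_unit actA.
Qed.

Definition unit_hom : module_hom M FGM := ModuleHom unit_linear.

(** Take g with g m = m. If the g-component vanishes, so does [ideal_to g m] by injectivity of
    [adjunct], and its value at the preimage of the generator of Rg is m. *)
Lemma unit_inj : injective unit_hom.
Proof.
suff unit0 m : unit_hom m = 0 -> m = 0.
  move=> x y exy; apply/eqP; rewrite -subr_eq0; apply/eqP/unit0.
  by rewrite module_homB exy subrr.
move=> m0; have [g gm] := local_unit1 hR m uM.
have : ideal_to g m = 0.
  apply: (@adjunct_inj _ _ hS G addG); apply: module_hom_ext => q.
  have := congr1 (fun x : FGM => ext_val x (existT _ g q) (sval g)) m0.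
  rewrite ext_val_unit gm => ->.
  by apply: ext_inj => e' q' a; rewrite adjunctE.
move/(congr1 (fun k : module_hom _ M => k (counit_inv (ideal_proj g) (ideal_gen g)))).
by rewrite /ideal_to /= counit_invK /ideal_mul ideal_genE gm.
Qed.

(** z is represented at some g by the adjunct of a map phi from G(F(Rg)) to M. As G(F(Rg)) is
    isomorphic to Rg, phi is determined by the image m of the generator. *)
Lemma unit_surj z : exists m, unit_hom m = z.
Proof.
have [g [y zE]] := ext_valP z.
have [phi phiE] := @adjunct_surj _ _ hS G addG M (F (ideal_proj g)) y.
pose m := phi (counit_inv (ideal_proj g) (ideal_gen g)).
have gen_g : act (sval g) (ideal_gen g) = ideal_gen g := act_ideal_gen (ideal_gen g).
have gm : act (sval g) m = m by rewrite /m -!module_hom_act gen_g.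
have phi_m : phi = ideal_to g m.
  apply: module_hom_ext => x; rewrite -[in LHS](counitK x) /ideal_to /= /ideal_mul.
  by rewrite /m -!module_hom_act act_ideal_gen.
exists m; apply: ext_inj => e q r; rewrite ext_val_unit zE -phiE phi_m.
by rewrite raw_unit_transfer ideal_val_act ideal_genE -actA gm.
Qed.

End Unit.

Lemma unit_natural (M N : lmodule R) (uM : unitary M) (uN : unitary N)
    (f : module_hom M N) m :
  unit_hom uN (f m) =
  extension_map hR addF (extension_map hS addG f) (unit_hom uM m).
Proof.
apply: ext_inj => e q r.
rewrite [LHS](ext_val_unit uN) [RHS]ext_val_map (ext_val_unit uM) adjunct_naturalr.
congr (adjunct _ _ _ q); apply: module_hom_ext => x.
by rewrite /= /ideal_mul !module_hom_act.
Qed.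

Lemma extension_functor_inverse :
  naturally_isomorphic
    (functor_comp (extension_functor hR addF) (extension_functor hS addG))
    (functor_id (RMod R)).
Proof.
apply: natural_iso_sym; exists (fun M => unit_hom (svalP M)); split=> [M|M N f].
  by apply: bijective_isomorphism; [apply: unit_inj | apply: unit_surj].
by apply: module_hom_ext => m; apply: unit_natural.
Qed.

End Composite.

(** * The cycle of implications (a), (b), (c), (a) *)

Theorem theoremB (R S : rng)
    (hR : has_local_units R) (hS : has_local_units S) :
  [<-> (* (a) *) Morita_equivalent R S;
       (* (b) *) exists F : functor (ProjMod R) (ProjMod S),
                   [/\ additive_functor F, equivalence F
                     & preserves_reflects_fg F];
       (* (c) *) exists F : functor (projMod R) (projMod S),
                   additive_functor F /\ equivalence F].
Proof.
split; last split.
- move=> [F [addF [G FG]]].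
  have GF : mutually_inverse G F by case: FG.
  have [X|Y|F' [addF' eqF' F'E]] := full_subcategory_equivalence
    (P := @projective (RMod R)) (Q := @projective (RMod S)) FG addF.
  + exact: (projective_equivalence FG).
  + exact: (projective_equivalence GF).
  exists F'; split=> // X; rewrite /Proj_module F'E; split=> fgX.
    by apply: compact_fg => //; apply: (compact_equivalence FG); apply: fg_compact.
  (* G only shows that G (F X) is finitely generated; u carries this to X. *)
  have [u [iu _]] := FG.1.
  apply: (fg_iso (iu (sval X))); apply: compact_fg => //.
  by apply: (compact_equivalence GF); apply: fg_compact.
- move=> [F [addF [G [GF FG]] fgF]].
  have FP (X : ProjMod R) :
      projective (sval X) /\ finitely_generated (RMod_module (sval X)) ->
      projective (sval (F X)) /\ finitely_generated (RMod_module (sval (F X))).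
    by move=> [_ fgX]; split; [apply: svalP (F X) | apply/(fgF X)].
  have GQ (Y : ProjMod S) :
      projective (sval Y) /\ finitely_generated (RMod_module (sval Y)) ->
      projective (sval (G Y)) /\ finitely_generated (RMod_module (sval (G Y))).
    move=> [_ fgY]; split; [apply: svalP (G Y) | apply/(fgF (G Y))].
    (* What remains is that F (G Y) is finitely generated, and it is isomorphic to Y. *)
    have [w [iw _]] := natural_iso_sym FG.
    by apply: fg_iso (full_subcategory_iso (iw Y)) fgY.
  exact: (full_subcategory_shrink (conj GF FG) addF (fun=> @proj1 _ _)
    (fun=> @proj1 _ _) FP GQ).
- move=> [F [addF [G FG]]]; have addG := inverse_additive FG addF.
  (* Extension reverses direction: G from proj S to proj R yields a functor from RMod R to RMod S.
     Both composites are handled by the same lemma, with R and S exchanged. *)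
  exists (extension_functor hS addG); split; first exact: extension_functor_additive.
  exists (extension_functor hR addF).
  have [/natural_iso_inverse[u [v [vu uv nu _]]]
    /natural_iso_inverse[u' [v' [vu' uv' nu' _]]]] := FG.
  split; first exact: (extension_functor_inverse hR hS addF addG vu uv nu).
  exact: (extension_functor_inverse hS hR addG addF vu' uv' nu').
Qed.
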